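(* Let $n$ be a natural number and $L$ a list of natural numbers of length at most $n+1$. Let $P$ be a predicate on families with $P(\emptyset)$ true, and let $v_{[\,]}=\{\emptyset\}$ (the collection whose only member is the empty family). Let $Q$ be a predicate on pairs (family, set) that incrementally checks $P$ and is preserved by injective functions. Let $\Pi$ be a list containing all permutations of $[n]$, and let $\mathrm{upd}(\mathcal{F},L')=\mathrm{base}\bigl(\mathcal{F}\otimes_Q\mathcal{S}(n,|L'|-1),\Pi\bigr)$, where $|L'|$ is the length of $L'$. Then $\mathrm{enum\_rec}(L,v_{[\,]},\mathrm{upd})$ is an iso-base of $\mathcal{L}(L,n,P)$.
   Context: All sets and families are finite; sets are sets of natural numbers, $[n]=\{0,\ldots,n-1\}$, and a family $F$ is over $[n]$ if $\bigcup F\subseteq[n]$. For a list $L=[l_0,\ldots,l_m]$, $F$ is $L$-partitioned if every $A\in F$ has $|A|\le m$ and for each $0\le i\le m$ exactly $l_i$ members of $F$ have $i$ elements (for the empty list: $F=\emptyset$). $\mathcal{L}(L,n,P)$ is the collection of $L$-partitioned families over $[n]$ satisfying $P$. $\mathcal{S}(n,m)$ is the collection of $m$-element subsets of $[n]$. For a collection $\mathcal{F}$ and family $G$, $\mathcal{F}\otimes_Q G=\bigcup_{A\in G}\{F\cup\{A\}:F\in\mathcal{F},A\notin F,Q\,F\,A\}$. $Q$ incrementally checks $P$ if for every family $F$ and set $A$ with $|A|\ge|A'|$ for all $A'\in F$ and $A\notin F$: $P(F\cup\{A\})\iff(P(F)\text{ and } Q\,F\,A)$. $Q$ is preserved by injective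 functions if for all $F,A$ and $f$ injective on $\bigcup F\cup A$, $Q\,F\,A$ implies $Q\,\{f[B]:B\in F\}\,f[A]$. Families $F,F'$ are isomorphic if there is a bijection $f:\bigcup F\to\bigcup F'$ with $\{f[B]:B\in F\}=F'$. A collection $\mathcal{F}_b$ iso-represents $\mathcal{F}$ if each member of $\mathcal{F}$ is isomorphic to some member of $\mathcal{F}_b$; it is an iso-base of $\mathcal{F}$ if moreover no two distinct members of $\mathcal{F}_b$ are isomorphic. The function $\mathrm{base}(\mathcal{F},\Pi)$ (for a collection $\mathcal{F}$ of families over $[n]$ and a list $\Pi$ of permutations of $[n]$) is computed by sieving: repeatedly choose a member $F$ of the remaining collection, put it into the result, and remove from the remaining collection all families $\{\pi[B]:B\in F\}$ for $\pi\in\Pi$ (and $F$ itself), until the remaining collection is empty. For lists: $\mathrm{last}(L)$ is the last element, $\mathrm{butlast}(L)$ is $L$ without its last element, and $\mathrm{declast}(L)$ is $L$ with its last element decreased by one. The function $\mathrm{enum\_rec}$ is defined recursively by: $\mathrm{enum\_rec}(L,v,\mathrm{upd})=v$ if $L=[\,]$; $=\mathrm{enum\_rec}(\mathrm{butlast}(L),v,\mathrm{upd})$ if $L\ne[\,]$ and $\mathrm{last}(L)=0$; and $=\mathrm{upd}(\mathrm{enum\_rec}(\mathrm{declast}(L),v,\mathrm{upd}),L)$ otherwise. *)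

(* Defs.v *)
From mathcomp Require Import all_boot all_fingroup.
From mathcomp Require Import finmap boolp classical_sets.
From Stdlib Require Import Recdef.

Set Implicit Arguments.
Unset Strict Implicit.
Unset Printing Implicit Defensive.

Local Open Scope fset_scope.
Local Open Scope nat_scope.

Notation natset := {fset nat}.
Notation setfam := {fset natset}.
Notation collection := (set setfam).

Definition initseg (n : nat) : natset := [fset i in iota 0 n].

Definition union (F : setfam) : natset := \bigcup_(A <- F) A.

Definition over (n : nat) (F : setfam) : Prop := union F `<=` initseg n.

Definition fam_image (f : nat -> nat) (F : setfam) : setfam :=
  [fset [fset f x | x in B] | B : natset in F].

(* With L = [l_0, ..., l_m], the bound |A| <= m reads |A| < size L; this form
   also covers L = [::], for which it forces F to be empty. *)
Definition partitioned (L : seq nat) (F : setfam) : Prop :=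
  (forall A, A \in F -> #|` A| < size L) /\
  (forall i, i < size L -> #|` [fset A in F | #|` A| == i]| = nth 0 L i).

Definition partitioned_families (L : seq nat) (n : nat) (P : setfam -> Prop) :
    collection :=
  [set F | [/\ partitioned L F, over n F & P F]]%classic.

Definition msubsets (n m : nat) : setfam :=
  [fset A in fpowerset (initseg n) | #|` A| == m].

Definition otimes (Q : setfam -> natset -> Prop) (C : collection) (G : setfam) :
    collection :=
  [set H | exists (A : natset) (F : setfam),
     [/\ A \in G, C F, A \notin F, Q F A & H = (A |` F)%fset]]%classic.

Definition incrementally_checks (Q : setfam -> natset -> Prop)
    (P : setfam -> Prop) : Prop :=
  forall (F : setfam) (A : natset),
    (forall A', A' \in F -> #|` A'| <= #|` A|) -> A \notin F ->
    (P (A |` F) <-> P F /\ Q F A).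

Definition preserved_by_injective (Q : setfam -> natset -> Prop) : Prop :=
  forall (F : setfam) (A : natset) (f : nat -> nat),
    {in union F `|` A &, injective f} ->
    Q F A -> Q (fam_image f F) [fset f x | x in A].

(* A map between unions of families is given by a total function on nat, of
   which only the restriction to the domain matters. *)
Definition isomorphic (F F' : setfam) : Prop :=
  exists f : nat -> nat,
    [/\ {in union F &, injective f},
        [fset f x | x in union F] = union F' &
        fam_image f F = F'].

Definition iso_represents (Cb C : collection) : Prop :=
  forall F, C F -> exists2 F', Cb F' & isomorphic F F'.

Definition iso_base (Cb C : collection) : Prop :=
  iso_represents Cb C /\
  (forall F F', Cb F -> Cb F' -> F <> F' -> ~ isomorphic F F').

(* s, extended by the identity outside {0, ..., n-1} *)
Definition perm_nat (n : nat) (s : 'S_n) (x : nat) : nat :=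
  if insub x is Some i then val (s i) else x.

(* [sieve Pi C R]: some run of the sieving procedure on C returns R; every
   step is free to choose any member F of the remaining collection. *)
Inductive sieve (n : nat) (Pi : seq 'S_n) : collection -> collection -> Prop :=
| sieve_done : sieve Pi set0 set0
| sieve_step (C R : collection) (F : setfam) :
    C F ->
    sieve Pi
      (C `\` [set G | G = F \/
                exists2 s, s \in Pi & G = fam_image (perm_nat s) F])%classic R ->
    sieve Pi C ([set F] `|` R)%classic.

(* [base] sieves collections of families over [n]; how it makes the choices
   (which may depend on the whole run) is left arbitrary. *)
Definition computed_by_sieving (n : nat)
    (base : collection -> seq 'S_n -> collection) : Prop :=
  forall (C : collection) (Pi : seq 'S_n),
    (forall F, C F -> over n F) -> sieve Pi C (base C Pi).

Definition butlast (L : seq nat) : seq nat := take (size L).-1 L.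

Definition declast (L : seq nat) : seq nat :=
  rcons (butlast L) (last 0 L).-1.

Lemma butlast_rcons (L : seq nat) (x : nat) : butlast (rcons L x) = L.
Proof. by rewrite /butlast size_rcons /= -cats1 take_size_cat. Qed.

Lemma declast_rcons (L : seq nat) (x : nat) :
  declast (rcons L x) = rcons L x.-1.
Proof. by rewrite /declast butlast_rcons last_rcons. Qed.

Function enum_rec (V : Type) (v : V) (upd : V -> seq nat -> V) (L : seq nat)
    {measure (fun L => size L + sumn L) L} : V :=
  if nilp L then v
  else if last 0 L == 0 then enum_rec v upd (butlast L)
  else upd (enum_rec v upd (declast L)) L.
Proof.
- move=> V v upd; case/lastP => [//|L x] _ _; apply/ltP.
  by rewrite butlast_rcons size_rcons sumn_rcons addSn ltnS leq_add2l leq_addr.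
- move=> V v upd; case/lastP => [//|L x] _; rewrite last_rcons => x0.
  apply/ltP; rewrite declast_rcons !size_rcons !sumn_rcons ltn_add2l ltn_add2l.
  by case: x x0.
Defined.

Lemma over_fpowerset (n : nat) (F : setfam) :
  over n F -> F \in fpowerset (fpowerset (initseg n)).
Proof.
move=> oF; rewrite fpowersetE; apply/fsubsetP => A AF; rewrite fpowersetE.
apply: fsubset_trans oF; exact: bigfcup_sup.
Qed.

Lemma sieve_exists (n : nat) (Pi : seq 'S_n) (C : collection) :
  (forall F, C F -> over n F) -> exists R, sieve Pi C R.
Proof.
move=> oC; have {oC} : (forall F, C F -> F \in fpowerset (fpowerset (initseg n))).
  by move=> F /oC/over_fpowerset.
move: (fpowerset _) => U; have [k] := ubnP #|` U|.
elim: k U C => // k IHk U C; rewrite ltnS => Uk CU.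
have [->|/set0P[F CF]] := eqVneq C set0; first by exists set0; exact: sieve_done.
have [||R sR] := IHk (U `\ F)
  (C `\` [set G | G = F \/
                exists2 s, s \in Pi & G = fam_image (perm_nat s) F])%classic.
- by apply: leq_trans Uk; rewrite [X in _ < X](cardfsD1 F) CU.
- move=> G [CG /= nG]; rewrite !inE CU // andbT.
  by apply/eqP => GF; apply: nG; left.
- by exists ([set F] `|` R)%classic; exact: sieve_step CF sR.
Qed.

Lemma computed_by_sieving_exists (n : nat) :
  exists base : collection -> seq 'S_n -> collection, computed_by_sieving base.
Proof.
have H (CP : collection * seq 'S_n) :
    exists R, (forall F, CP.1 F -> over n F) -> sieve CP.2 CP.1 R.
  have [oC|noC] := pselect (forall F, CP.1 F -> over n F); last by exists set0.
  by have [R sR] := sieve_exists CP.2 oC; exists R.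
have [g gP] := choice H.
by exists (fun C Pi => g (C, Pi)) => C Pi; exact: (gP (C, Pi)).
Qed.

(* Main.v *)
Require Import Defs.
From mathcomp Require Import all_boot all_fingroup.
From mathcomp Require Import finmap boolp classical_sets.
From mathcomp Require Import primitive_action alt.

(** Families over [n] are isomorphic exactly when some permutation of [n] maps
    one to the other, because an injection between subsets of [n] extends to a
    permutation. Hence sieving a collection with all permutations of [n] leaves
    one member of each isomorphism class. By induction on [L] it then remains to
    see that adding a set of maximal size to representatives reaches every
    isomorphism class of the next level: remove a largest set from a family,
    move the rest to its representative by a permutation, and add the image of
    the removed set. *)

Set Implicit Arguments.
Unset Strict Implicit.
Unset Printing Implicit Defensive.

Local Open Scope fset_scope.
Local Open Scope nat_scope.

(* [over] alone now denotes the constant of the [under] tactic. *)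
Local Notation over := Defs.over.

(** The symmetric group on [T] is [#|T|]-transitive, hence [#|D|]-transitive. As [f] is injective on
    [D], both the enumeration of [D] and its image under [f] are duplicate-free tuples, so some
    permutation carries one to the other. *)
Lemma perm_extends (T : finType) (D : {set T}) (f : T -> T) :
  {in D &, injective f} -> exists s : {perm T}, {in D, s =1 f}.
Proof.
move=> injf.
pose x : #|D|.-tuple T := enum_tuple D.
pose y : #|D|.-tuple T := map_tuple f x.
have tr := ntransitive_weak (max_card (mem D)) (Sym_trans T).
have xD : x \in dtuple_on #|D| (finset.setTfor T).
  by rewrite inE enum_uniq; apply/fintype.subsetP => i; rewrite finset.in_setT.
have yD : y \in dtuple_on #|D| (finset.setTfor T).
  rewrite inE map_inj_in_uniq ?enum_uniq; last first.
    by move=> a b; rewrite !mem_enum; exact: injf.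
  by apply/fintype.subsetP => i; rewrite finset.in_setT.
have [s _ yE] := atransP2 tr xD yD.
exists s => i iD.
have /eq_in_map : map f (enum D) = map s (enum D) by exact: (congr1 val yE).
by move=> ->//; rewrite mem_enum.
Qed.

(** * Unions and images of families *)

Lemma mem_union (F : setfam) (x : nat) :
  reflect (exists2 A, A \in F & x \in A) (x \in union F).
Proof.
rewrite /union; apply: (iffP (bigfcupP _ _ _ _)) => [[A]|[A AF xA]].
  by rewrite andbT; exists A.
by exists A; rewrite ?AF.
Qed.

Lemma mem_initseg (n x : nat) : (x \in initseg n) = (x < n).
Proof. by rewrite inE /= mem_iota. Qed.

Lemma overP (n : nat) (F : setfam) :
  over n F <-> forall A x, A \in F -> x \in A -> x < n.
Proof.
split=> [/fsubsetP oF A x AF xA|oF].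
  by rewrite -mem_initseg oF //; apply/mem_union; exists A.
by apply/fsubsetP => x /mem_union[A AF xA]; rewrite mem_initseg; apply: oF xA.
Qed.

Lemma over_fsetU1 (n : nat) (A : natset) (F : setfam) :
  over n (A |` F) <-> A `<=` initseg n /\ over n F.
Proof.
split=> [/overP oAF|[/fsubsetP AsubI /overP oF]].
  split; last by apply/overP => B x BF; apply: oAF; rewrite fset1Ur.
  by apply/fsubsetP => x xA; rewrite mem_initseg (oAF A) // fset1U1.
apply/overP => B x /fset1UP[->|BF] xB; last exact: oF xB.
by rewrite -mem_initseg AsubI.
Qed.

Lemma eq_in_fam_image (f g : nat -> nat) (F : setfam) :
  {in union F, f =1 g} -> fam_image f F = fam_image g F.
Proof.
move=> fg; apply: eq_in_imfset => //= A AF; apply: eq_in_imfset => //= x xA.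
by apply: fg; apply/mem_union; exists A.
Qed.

Lemma imfset_id_in (K : choiceType) (f : K -> K) (A : {fset K}) :
  {in A, f =1 id} -> [fset f x | x in A] = A.
Proof.
move=> fid; apply/fsetP => x; apply/imfsetP/idP => /= [[y yA ->]|xA].
  by rewrite fid.
by exists x; rewrite ?fid.
Qed.

Lemma imfsetK (K : choiceType) (f g : K -> K) (A : {fset K}) :
  {in A, cancel f g} -> [fset g y | y in [fset f x | x in A]] = A.
Proof. by move=> fK; rewrite -imfset_comp; exact: imfset_id_in. Qed.

Lemma fam_image_comp (f g : nat -> nat) (F : setfam) :
  fam_image g (fam_image f F) = fam_image (g \o f) F.
Proof.
rewrite /fam_image -imfset_comp; apply: eq_imfset => [A|//] /=.
by rewrite -imfset_comp.
Qed.

Lemma fam_imageK (f g : nat -> nat) (F : setfam) :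
  {in union F, cancel f g} -> fam_image g (fam_image f F) = F.
Proof.
move=> fK; rewrite /fam_image -imfset_comp; apply: imfset_id_in => A AF /=.
apply: imfsetK => x xA.
by apply: fK; apply/mem_union; exists A.
Qed.

Lemma fam_image_fsetU1 (f : nat -> nat) (A : natset) (F : setfam) :
  fam_image f (A |` F) = [fset f x | x in A] |` fam_image f F.
Proof. by rewrite /fam_image imfsetU imfset_fset1. Qed.

Lemma union_fam_image (f : nat -> nat) (F : setfam) :
  union (fam_image f F) = [fset f x | x in union F].
Proof.
apply/fsetP => y; apply/mem_union/imfsetP => /=.
  move=> [_ /imfsetP[A /= AF ->] /imfsetP[x /= xA ->]].
  by exists x => //; apply/mem_union; exists A.
move=> [x /mem_union[A AF xA] ->]; exists [fset f z | z in A].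
  exact: in_imfset.
exact: in_imfset.
Qed.

(** * Permutations of [[n]] acting on families, and isomorphism *)

Lemma perm_natE (n : nat) (s : 'S_n) (i : 'I_n) : perm_nat s i = s i.
Proof. by rewrite /perm_nat valK. Qed.

Lemma perm_nat_out (n : nat) (s : 'S_n) (x : nat) :
  n <= x -> perm_nat s x = x.
Proof. by move=> nx; rewrite /perm_nat insubF // ltnNge nx. Qed.

Lemma perm_natK (n : nat) (s : 'S_n) :
  cancel (perm_nat s) (perm_nat s^-1).
Proof.
move=> x; have [xn|nx] := ltnP x n; last by rewrite !perm_nat_out.
by rewrite (perm_natE s (Ordinal xn)) perm_natE permK.
Qed.

Lemma perm_nat_lt (n : nat) (s : 'S_n) (x : nat) :
  x < n -> perm_nat s x < n.
Proof. by move=> xn; rewrite (perm_natE s (Ordinal xn)). Qed.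

Lemma perm_nat_inj (n : nat) (s : 'S_n) : injective (perm_nat s).
Proof. exact: can_inj (perm_natK s). Qed.

Lemma perm_nat_initseg (n : nat) (s : 'S_n) (A : natset) :
  A `<=` initseg n -> [fset perm_nat s x | x in A] `<=` initseg n.
Proof.
move=> /fsubsetP AI; apply/fsubsetP => _ /imfsetP[x /= /AI + ->].
by rewrite !mem_initseg; apply: perm_nat_lt.
Qed.

Lemma fam_image_permK (n : nat) (s : 'S_n) (F : setfam) :
  fam_image (perm_nat s^-1) (fam_image (perm_nat s) F) = F.
Proof. by apply: fam_imageK => x _; exact: perm_natK. Qed.

Lemma isomorphic_image (F : setfam) (f : nat -> nat) :
  {in union F &, injective f} -> isomorphic F (fam_image f F).
Proof. by move=> finj; exists f; split; rewrite ?union_fam_image. Qed.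

Lemma isomorphic_perm (n : nat) (F G : setfam) :
  over n F -> over n G -> isomorphic F G ->
  exists s : 'S_n, fam_image (perm_nat s) F = G.
Proof.
move=> oF oG [f [finj fU fF]].
pose D := [set i : 'I_n | val i \in union F].
pose g (i : 'I_n) := insubd i (f i).
have gE i : i \in D -> g i = f i :> nat.
  rewrite inE => iU; rewrite val_insubd -mem_initseg.
  by rewrite (fsubsetP oG) // -fU; apply: in_imfset.
have ginj : {in D &, injective g}.
  move=> i j iD jD /(congr1 val) /=; rewrite !gE // => fij.
  by move: iD jD; rewrite !inE => iD jD; apply/val_inj/finj.
have [s sg] := perm_extends ginj.
exists s; rewrite -fF; apply: eq_in_fam_image => x xU.
have xn : x < n by rewrite -mem_initseg (fsubsetP oF).
have xD : Ordinal xn \in D by rewrite inE.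
by rewrite (perm_natE s (Ordinal xn)) sg // gE.
Qed.

Lemma isomorphic_refl (F : setfam) : isomorphic F F.
Proof.
(* [img] is the map on sets inside [fam_image id], so rewriting with it turns the right-hand [F]
   into an image under the identity. *)
pose img (A : natset) := [fset x | x in A].
rewrite -[X in isomorphic _ X](@imfset_id_in _ img).
  by apply: isomorphic_image => x y.
by move=> A _; exact: imfset_id_in.
Qed.

Lemma isomorphic_trans (F G H : setfam) :
  isomorphic F G -> isomorphic G H -> isomorphic F H.
Proof.
move=> [f [finj fU fF]] [g [ginj _ <-]]; rewrite -{}fF in ginj *.
rewrite fam_image_comp; apply: isomorphic_image => x y xU yU /= /ginj.
by rewrite union_fam_image !in_imfset //; auto.
Qed.

(** * Sieving *)

Lemma sieve_sub (n : nat) (Pi : seq 'S_n) (C R : collection) :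
  sieve Pi C R -> (R `<=` C)%classic.
Proof.
elim=> {C R} // C R F CF _ IH G [->//|/IH []//].
Qed.

(** A family leaves the remaining collection only as the chosen member or as an image of it under a
    permutation; either way it is isomorphic to the chosen member. *)
Lemma sieve_represents (n : nat) (Pi : seq 'S_n) (C R : collection) :
  sieve Pi C R -> iso_represents R C.
Proof.
elim=> {C R} // C R F CF _ IH G CG.
have [[->|[s _ ->]]|nG] := pselect (G = F \/
    exists2 s, s \in Pi & G = fam_image (perm_nat s) F).
- by exists F; [left|exact: isomorphic_refl].
- exists F; first by left.
  rewrite -[X in isomorphic _ X](fam_image_permK s).
  by apply: isomorphic_image => x y _ _; exact: perm_nat_inj.
- by have [|H RH GH] := IH G; [|exists H; [right|]].
Qed.

(** Choosing [F] discards all its images under permutations, which by [isomorphic_perm] are all the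
    families over [[n]] isomorphic to it; so nothing chosen later is isomorphic to [F]. *)
Lemma sieve_iso_base (n : nat) (Pi : seq 'S_n) (C R : collection) :
  (forall s : 'S_n, s \in Pi) -> (forall F, C F -> over n F) ->
  sieve Pi C R -> iso_base R C.
Proof.
move=> allPi oC sCR; split; first exact: sieve_represents sCR.
elim: sCR oC => {C R} // C R F CF sR IH oC.
have nF G : R G -> forall s : 'S_n, G <> fam_image (perm_nat s) F.
  move=> /(sieve_sub sR) [_ nG] s GE; apply: nG; right; by exists s.
have oR G : R G -> over n G by move=> /(sieve_sub sR) [CG _]; exact: oC.
have oF := oC _ CF.
move=> G H [->|RG] [->|RH] GH iGH //.
- by have [s /esym/nF] := isomorphic_perm oF (oR _ RH) iGH; exact.
(* Here the permutation leads from [G] to [F]; its inverse exhibits [G] as a discarded image of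
   [F]. *)
- have [s sGF] := isomorphic_perm (oR _ RG) oF iGH.
  by apply: (nF _ RG s^-1%g); rewrite -sGF fam_image_permK.
- by apply: IH iGH => // K [CK _]; exact: oC.
Qed.

(** * Unfolding the recursion at the end of the list *)

Lemma enum_rec_nil (V : Type) (v : V) (upd : V -> seq nat -> V) :
  enum_rec v upd [::] = v.
Proof. by rewrite enum_rec_equation. Qed.

Lemma enum_rec_rcons0 (V : Type) (v : V) (upd : V -> seq nat -> V)
    (L : seq nat) :
  enum_rec v upd (rcons L 0) = enum_rec v upd L.
Proof.
by rewrite enum_rec_equation /nilp size_rcons last_rcons butlast_rcons.
Qed.

Lemma enum_rec_rconsS (V : Type) (v : V) (upd : V -> seq nat -> V)
    (L : seq nat) (k : nat) :
  enum_rec v upd (rcons L k.+1) =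
  upd (enum_rec v upd (rcons L k)) (rcons L k.+1).
Proof.
by rewrite enum_rec_equation /nilp size_rcons last_rcons declast_rcons.
Qed.

(** * Partitioned families and extension by one set *)

Lemma partitioned_nil (F : setfam) : partitioned [::] F -> F = fset0.
Proof.
by move=> [szF _]; apply/fsetP => A; rewrite in_fset0; apply/negP => /szF.
Qed.

Lemma partitioned_rcons0 (L : seq nat) (F : setfam) :
  partitioned (rcons L 0) F -> partitioned L F.
Proof.
move=> [szF cntF]; split=> [A AF|i iL]; last first.
  by rewrite cntF ?size_rcons 1?ltnW // nth_rcons iL.
have := szF _ AF; rewrite size_rcons ltnS leq_eqVlt => /orP[/eqP AL|//].
have : #|` [fset B in F | #|` B| == size L]| = 0.
  by rewrite cntF ?size_rcons // nth_rcons ltnn eqxx.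
move=> /cardfs0_eq/fsetP/(_ A).
by rewrite !inE /= AF AL eqxx.
Qed.

(** The positive last count provides a set [A] of the largest allowed size; deleting it lowers the
    count of that size only. *)
Lemma partitioned_rconsS (L : seq nat) (k : nat) (F : setfam) :
  partitioned (rcons L k.+1) F ->
  exists2 A, A \in F & #|` A| = size L /\ partitioned (rcons L k) (F `\ A).
Proof.
move=> [szF cntF].
have cntL : #|` [fset B in F | #|` B| == size L]| = k.+1.
  by rewrite cntF ?size_rcons // nth_rcons ltnn eqxx.
have [A] : exists A, A \in [fset B in F | #|` B| == size L].
  by apply/fset0Pn; rewrite -cardfs_gt0 cntL.
rewrite !inE /= => /andP[AF /eqP AL]; exists A => //; split=> //; split.
  by move=> B /fsetD1P[_ /szF]; rewrite !size_rcons.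
move=> i; rewrite size_rcons => iL.
have -> : [fset B in F `\ A | #|` B| == i] = [fset B in F | #|` B| == i] `\ A.
  by apply/fsetP => B; rewrite !inE /= andbA.
have := cardfsD1 A [fset B in F | #|` B| == i].
rewrite cntF ?size_rcons // !inE /= AF AL !nth_rcons.
have [iltL|] := ltnP i (size L); first by rewrite gtn_eqF.
move=> Li; have -> : i = size L by apply/eqP; rewrite eqn_leq -ltnS iL.
by rewrite eqxx => -[].
Qed.

Lemma mem_msubsets (n m : nat) (A : natset) :
  (A \in msubsets n m) = (A `<=` initseg n) && (#|` A| == m).
Proof. by rewrite !inE /= fpowersetE. Qed.

Lemma over_otimes (n m : nat) (Q : setfam -> natset -> Prop) (C : collection) :
  (forall F, C F -> over n F) ->
  forall F, otimes Q C (msubsets n m) F -> over n F.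
Proof.
move=> oC _ [A [F [+ /oC oF _ _ ->]]]; rewrite mem_msubsets => /andP[AI _].
exact/over_fsetU1.
Qed.

Lemma otimes_represents (n : nat) (P : setfam -> Prop)
    (Q : setfam -> natset -> Prop) (L : seq nat) (k : nat) (C : collection) :
  incrementally_checks Q P -> preserved_by_injective Q ->
  (forall F, C F -> over n F) ->
  iso_represents C (partitioned_families (rcons L k) n P) ->
  iso_represents (otimes Q C (msubsets n (size L)))
    (partitioned_families (rcons L k.+1) n P).
Proof.
move=> QP injQ oC repC F [pF oF PF].
have [A AF [AL pFA]] := partitioned_rconsS pF.
move: oF PF; rewrite -(fsetD1K AF) => /over_fsetU1[AI oFA] PF.
(* The incremental check applies because [A] has the largest size in the family. *)
have [||PFA QFA] := (QP (F `\ A) A _ _).1 PF.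
- by move=> B /fsetD1P[_ /(proj1 pF)]; rewrite size_rcons AL.
- by rewrite !inE eqxx.
have [G CG isoG] : exists2 G, C G & isomorphic (F `\ A) G.
  by apply: repC; split.
have [s sG] := isomorphic_perm oFA (oC _ CG) isoG.
(* The image of the whole family under [s] is isomorphic to it, and equals [G] with the image of [A]
   added. *)
exists (fam_image (perm_nat s) (A |` (F `\ A))); last first.
  by apply: isomorphic_image => x y _ _; exact: perm_nat_inj.
exists [fset perm_nat s x | x in A], G; split=> //.
- rewrite mem_msubsets perm_nat_initseg //= card_imfset ?AL //.
  exact: perm_nat_inj.
(* Were the image of [A] in [G], pulling back along the inverse of [s] would put [A] in the family
   it was removed from. *)
- rewrite -sG; apply/negP => /imfsetP[B /= BFA].
  move=> /(congr1 (fun D : natset => [fset perm_nat s^-1 y | y in D])).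
  rewrite !(imfsetK (in1W (perm_natK s))) => AB.
  by rewrite -AB !inE eqxx in BFA.
- rewrite -sG; apply: injQ => // x y _ _; exact: perm_nat_inj.
- by rewrite fam_image_fsetU1 sG.
Qed.

Theorem theorem5 (n : nat) (L : seq nat) (P : setfam -> Prop)
    (Q : setfam -> natset -> Prop) (Pi : seq 'S_n)
    (base : collection -> seq 'S_n -> collection) :
  size L <= n.+1 ->
  P fset0 ->
  incrementally_checks Q P ->
  preserved_by_injective Q ->
  (forall s : 'S_n, s \in Pi) ->
  computed_by_sieving base ->
  iso_base
    (enum_rec [set fset0]%classic
       (fun (C : collection) (L' : seq nat) =>
          base (otimes Q C (msubsets n (size L').-1)) Pi)
       L)
    (partitioned_families L n P).
Proof.
move=> _ _ QP injQ allPi sieveB.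
set upd := fun _ => _; set v := [set fset0]%classic.
(* The induction also carries being over [[n]]: sieving is specified only for such collections, and
   isomorphisms yield permutations of [[n]] only between such families. *)
suff [//] : iso_base (enum_rec v upd L) (partitioned_families L n P) /\
    forall F, enum_rec v upd L F -> over n F.
(* Induction on the list from its end, then on the last entry, follows the two recursive calls of
   [enum_rec]. *)
elim/last_ind: L => [|L k [IHb IHo]].
  rewrite enum_rec_nil; split; last first.
    by move=> _ ->; apply/overP => A x; rewrite in_fset0.
  split; last by move=> F G -> ->.
  by move=> F [/partitioned_nil-> _ _]; exists fset0; last exact: isomorphic_refl.
elim: k => [|k [[IHkr _] IHko]].
  rewrite enum_rec_rcons0; split=> //; split; last exact: IHb.2.
  by move=> F [/partitioned_rcons0 pF oF PF]; apply: IHb.1.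
rewrite enum_rec_rconsS /upd size_rcons /= -/upd.
have oO := over_otimes (m := size L) (Q := Q) IHko.
have sB := sieveB _ Pi oO.
have [rB nB] := sieve_iso_base allPi oO sB.
split; last by move=> F /(sieve_sub sB); exact: oO.
split=> // F /(otimes_represents QP injQ IHko IHkr)[G OG FG].
(* [G] may itself be sieved out, so its own representative [H] is taken. *)
have [H BH GH] := rB _ OG.
by exists H => //; exact: isomorphic_trans FG GH.
Qed.
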